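(* Let $K$ and $N>1$ be real numbers and let $(X,d,\nu)$ be a geodesic metric measure space satisfying the Bishop-Gromov inequality $[BG_{K,N}]$. Then for every real $r$ with $0<r<\pi\sqrt{(N-1)/\max\{K,0\}}$ (with the convention $1/0=\infty$), the coarse Ricci curvature $\kappa$ associated with the $r$-step random walk $\{m^r_x\}_{x\in X}$ satisfies $$\inf_{x,y\in X,\ x\neq y}\kappa(x,y)\ \geq\ 1-2r\,\frac{s_{K,N}(r)^{N-1}}{\int_0^r s_{K,N}(t)^{N-1}\,dt}.$$
   Context: A metric measure space $(X,d,\nu)$ is a complete separable metric space $(X,d)$ with a positive Radon measure $\nu$; $B_r(x)$ is the open ball of radius $r$ centered at $x$, and $0<\nu(B_r(x))<\infty$ for all $x\in X$, $r>0$. The space is geodesic if for any $x,y\in X$ there is a curve $\gamma:[0,1]\to X$ from $x$ to $y$ with $d(\gamma(s),\gamma(t))=|s-t|\,d(x,y)$ for all $s,t\in[0,1]$. For $K\in\mathbb{R}$, $N>1$, define $s_{K,N}:[0,\infty)\to\mathbb{R}$ by $s_{K,N}(t)=\sqrt{(N-1)/K}\,\sin(t\sqrt{K/(N-1)})$ if $K>0$, $s_{K,N}(t)=t$ if $K=0$, and $s_{K,N}(t)=\sqrt{(N-1)/(-K)}\,\sinh(t\sqrt{-K/(N-1)})$ if $K<0$. $(X,d,\nu)$ satisfies $[BG_{K,N}]$ if for all $x\in X$ and all real $0<r<R\le \pi\sqrt{(N-1)/\max\{K,0\}}$ (convention $1/0=\infty$), $$\frac{\nu(B_R(x))}{\nu(B_r(x))}\le\frac{\int_0^R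 s_{K,N}(t)^{N-1}dt}{\int_0^r s_{K,N}(t)^{N-1}dt}.$$ The $r$-step random walk is the family of probability measures $m^r_x=\frac{\chi_{B_r(x)}}{\nu(B_r(x))}\nu$, $x\in X$, where $\chi_{B_r(x)}$ is the characteristic function of $B_r(x)$. For a family $\{m_x\}_{x\in X}$ of Borel probability measures with finite first moment, the associated coarse Ricci curvature is $\kappa(x,y)=1-\frac{W_1(m_x,m_y)}{d(x,y)}$ for distinct $x,y\in X$, where $W_1(\mu,\mu')=\inf_{\xi}\int_{X\times X}d(x,y)\,d\xi(x,y)$, the infimum being over all couplings $\xi$ of $\mu$ and $\mu'$. *)

(* Defs.v *)
From HB Require Import structures.
From mathcomp Require Import all_boot all_order all_algebra.
From mathcomp Require Import all_classical all_reals all_analysis.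

Set Implicit Arguments.
Unset Strict Implicit.
Unset Printing Implicit Defensive.

Import Order.TTheory GRing.Theory Num.Theory.
Import numFieldNormedType.Exports.

Local Open Scope classical_set_scope.
Local Open Scope ring_scope.

HB.mixin Record Metric_isBorel (d : measure_display) (R : realType) T
    & Measurable d T & Metric R T := {
  measurable_borel : @measurable d T = <<s [set U : set T | open U] >>
}.

(* A complete metric space that carries its own Borel sigma-algebra. As every
   [measurableType] and every [completeType] does, it has a point. *)
#[short(type="completeBorelMetricType")]
HB.structure Definition CompleteBorelMetric (d : measure_display)
    (R : realType) :=
  { T of Measurable d T & Metric R T & Complete T & Metric_isBorel d R T }.

Section metric_measure_spaces.
Context {d : measure_display} {R : realType} {X : completeBorelMetricType d R}.

Definition separable_space : Prop :=
  exists2 D : set X, countable D & dense D.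

Definition geodesic_space : Prop :=
  forall x y : X, exists gamma : R -> X,
    [/\ gamma 0 = x, gamma 1 = y &
        forall s t : R, 0 <= s <= 1 -> 0 <= t <= 1 ->
          mdist (gamma s) (gamma t) = `|s - t| * mdist x y].

Definition radon (nu : {measure set X -> \bar R}) : Prop :=
  (forall x : X, exists2 U : set X, open_nbhs x U & (nu U < +oo)%E) /\
  (forall A : set X, measurable A ->
    nu A = ereal_sup [set nu C | C in [set C | compact C /\ C `<=` A]]).

Definition metric_measure_space (nu : {measure set X -> \bar R}) : Prop :=
  [/\ separable_space, radon nu &
      forall (x : X) (r : R), 0 < r -> (0 < nu (ball x r) < +oo)%E].

End metric_measure_spaces.

Arguments separable_space {d R} X.
Arguments geodesic_space {d R} X.

Section bishop_gromov.
Context {R : realType}.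
Local Notation mu := (@lebesgue_measure R).

Definition sinh (t : R) : R := (expR t - expR (- t)) / 2.

Definition s_KN (K N t : R) : R :=
  if 0 < K then
    Num.sqrt ((N - 1) / K) * sin (t * Num.sqrt (K / (N - 1)))
  else if K == 0 then t
  else Num.sqrt ((N - 1) / (- K)) * sinh (t * Num.sqrt (- K / (N - 1))).

Definition int_s_KN (K N r : R) : R :=
  (\int[mu]_(t in `[0, r]) (s_KN K N t `^ (N - 1)))%R.

Definition radius_bound (K N : R) : \bar R :=
  if Num.max K 0 == 0 then +oo%E
  else (pi * Num.sqrt ((N - 1) / Num.max K 0))%:E.

Definition BG {d : measure_display} {X : completeBorelMetricType d R}
    (K N : R) (nu : {measure set X -> \bar R}) : Prop :=
  forall (x : X) (r r' : R), 0 < r -> r < r' ->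
    (r'%:E <= radius_bound K N)%E ->
    (nu (ball x r') / nu (ball x r) <=
     (int_s_KN K N r' / int_s_KN K N r)%:E)%E.

End bishop_gromov.

Section coarse_ricci.
Context {d : measure_display} {R : realType} {X : completeBorelMetricType d R}.

Lemma open_mball (x : X) (r : R) : open (ball x r).
Proof.
rewrite openE => y; rewrite ballEmdist/= => xyr.
apply/nbhs_ballP; exists (r - mdist x y) => /=; first by rewrite subr_gt0.
move=> z; rewrite !ballEmdist/= => yz.
by rewrite (le_lt_trans (metric_triangle x y z))// -ltrBrDl.
Qed.

Lemma measurable_mball (x : X) (r : R) : measurable (ball x r).
Proof. by rewrite measurable_borel; apply: sub_sigma_algebra; exact: open_mball. Qed.

(* [nu] restricted to the ball and divided by the mass of the ball; the Dirac
   mass is the value of [mnormalize] when the mass of the ball is 0 or +oo. *)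
Definition random_walk (nu : {measure set X -> \bar R}) (r : R) (x : X) :
    probability X R :=
  mnormalize (mrestr nu (measurable_mball x r)) (\d_x).

Lemma random_walkE (nu : {measure set X -> \bar R}) (r : R) (x : X)
    (A : set X) : (0 < nu (ball x r) < +oo)%E ->
  random_walk nu r x A = (nu (A `&` ball x r) / nu (ball x r))%E.
Proof.
move=> /andP[b0 boo]; rewrite /random_walk /= /mnormalize /=.
have -> : mrestr nu (measurable_mball x r) [set: X] = nu (ball x r).
  by rewrite /mrestr setTI.
rewrite gt_eqF//= lt_eqF//=; congr (_ * _)%E.
have bfin : nu (ball x r) \is a fin_num by rewrite ge0_fin_numE// ltW.
by rewrite -[in RHS](fineK bfin) inver fine_eq0// gt_eqF.
Qed.

Definition coupling (m1 m2 : probability X R)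
    (xi : probability (X * X)%type R) : Prop :=
  forall A : set X, measurable A ->
    xi (A `*` setT) = m1 A /\ xi (setT `*` A) = m2 A.

Definition W1 (m1 m2 : probability X R) : \bar R :=
  ereal_inf [set (\int[xi]_z (mdist z.1 z.2)%:E)%E
            | xi in [set xi : probability (X * X)%type R | coupling m1 m2 xi]].

Definition coarse_ricci (m : X -> probability X R) (x y : X) : \bar R :=
  (1 - W1 (m x) (m y) / (mdist x y)%:E)%E.

End coarse_ricci.

(* Main.v *)
From HB Require Import structures.
Require Import Defs.
From mathcomp Require Import all_boot all_order all_algebra.
From mathcomp Require Import all_classical all_reals all_analysis.
From mathcomp Require Import measurable_realfun.
From mathcomp Require Import ring lra.

Import Order.TTheory GRing.Theory Num.Theory.
Import numFieldNormedType.Exports.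

Local Open Scope classical_set_scope.
Local Open Scope ring_scope.

(* Along a geodesic from [x] to [y] take [n] equally spaced steps of length
   [delta]. For neighbouring points [p], [q] the ball [B_(r-delta)(p)] lies in
   [B_r(p) `&` B_r(q)], so by Bishop-Gromov all but a fraction
   [1 - I(r-delta)/I(r)], about [delta s(r)^(N-1)/I(r)] with [I] the integral of
   [s^(N-1)], of the mass of [m_p] can stay in place on the way to [m_q]; the
   rest moves by at most [2r + delta]. Adding up the [n] steps and letting [n]
   tend to infinity gives [W_1(m_x, m_y) <= d(x,y) 2r s(r)^(N-1)/I(r)]. The
   steps are composed through an explicit Markov kernel, which avoids the gluing
   lemma for general couplings. *)

(** * Joint measurability of the distance *)

Lemma dense_mdist_lt {d : measure_display} {R : realType}
    {X : completeBorelMetricType d R} (D : set X) (x : X) (e : R) :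
  dense D -> 0 < e -> exists2 p, D p & mdist x p < e.
Proof.
move=> dD e0; have [|p [xp Dp]] := dD (ball x e) _ (open_mball x e).
  by exists x; rewrite ballEmdist/= mdistxx.
by exists p => //; move: xp; rewrite ballEmdist.
Qed.

(* The product sigma-algebra need not be the Borel one in general, so
   separability is what makes the distance jointly measurable. *)
Lemma measurable_mdist {d : measure_display} {R : realType}
    {X : completeBorelMetricType d R} :
  separable_space X ->
  measurable_fun setT (fun z : X * X => (mdist z.1 z.2 : R)).
Proof.
move=> [D /countable_injP[f injf] dD].
apply: (measurability _ (RGenInftyO.measurableE R)) => _ [_ [t ->] <-].
rewrite setTI.
(* Points are at distance less than [t] exactly when some [p] in [D] and rational [q] satisfy
   [mdist p x < q] and [mdist p y < t - q]. The injection [f] turns the union over [D] into one over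
   the naturals. *)
have -> : (fun z : X * X => mdist z.1 z.2) @^-1` `]-oo, t[ =
    \bigcup_n \bigcup_(p in [set p | D p /\ f p = n]) \bigcup_(q : rat)
      (ball p (ratr q) `*` ball p (t - ratr q)).
  apply/seteqP; split => [[x y]|[x y]]/=; rewrite in_itv/=.
    move=> xyt.
    (* With [p] closer to [x] than half of the slack [t - mdist x y], the interval from [mdist x p]
       to [t - mdist p y] is nonempty; [q] is taken in its lower half. *)
    have [|p Dp xp] := dense_mdist_lt D x ((t - mdist x y) / 2) dD.
      by rewrite divr_gt0// subr_gt0.
    have /rat_in_itvoo[q] :
        mdist x p < (mdist x p + (t - mdist p y)) / 2.
      have := metric_triangle p x y; rewrite (metric_sym p x); lra.
    rewrite in_itv/= => /andP[q1 q2].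
    exists (f p) => //; exists p => //; exists q => //=.
    rewrite !ballEmdist/= (metric_sym p x); split => //.
    have := metric_triangle p x y; rewrite (metric_sym p x); lra.
  move=> [n _ [p [Dp _]]] [q _]; rewrite !ballEmdist/= => -[px py].
  by have := metric_triangle x p y; rewrite (metric_sym x p); lra.
apply: bigcup_measurable => n _.
have [[p [Dp fp]]|np] := pselect (exists p, D p /\ f p = n).
  have -> : [set p | D p /\ f p = n] = [set p].
    apply/seteqP; split=> [q/= [Dq fq]|_ ->//=].
    by apply: injf; rewrite ?inE// fp.
  rewrite bigcup_set1; apply: bigcupT_measurable_rat => q.
  by apply: measurableX; exact: measurable_mball.
have -> : [set p | D p /\ f p = n] = set0.
  by rewrite -subset0 => p Dp; apply: np; exists p.
by rewrite bigcup_set0.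
Qed.

(** * Extending and starting couplings *)

(* The mass of [m2] on [C] stays in place with probability [alpha], and all the
   remaining mass is moved to an independent [rho]-distributed point. *)
Lemma coupling_extend {d : measure_display} {R : realType}
    {X : completeBorelMetricType d R} (m1 m2 m3 rho : probability X R)
    (xi : probability (X * X)%type R) (A B C : set X) (alpha L : R) :
  separable_space X -> coupling m1 m2 xi ->
  measurable A -> measurable B -> measurable C ->
  0 <= alpha <= 1 -> 0 <= L ->
  (forall E, measurable E ->
    m3 E = alpha%:E * m2 (E `&` C) + (1 - alpha%:E * m2 C) * rho E)%E ->
  m2 (~` A) = 0%E -> rho (~` B) = 0%E ->
  (forall z w, A z -> B w -> mdist z w <= L) ->
  exists2 xi' : probability (X * X)%type R, coupling m1 m3 xi' &
    (\int[xi']_z (mdist z.1 z.2)%:E <=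
     \int[xi]_z (mdist z.1 z.2)%:E + L%:E * (1 - alpha%:E * m2 C))%E.
Proof.
move=> sepX cpl mA mB mC alpha01 L0 m3E m2A rhoB ABL.
have md := measurable_mdist sepX.
(* An outcome is a pair drawn from [xi], an independent [rho]-point and a coin showing [true] with
   probability [alpha]. On the event [S] (second coordinate in [C], coin [true]) the map [phi] keeps
   the pair; otherwise it replaces the second coordinate by the [rho]-point. *)
pose P : probability ((X * X) * X * bool)%type R :=
  ((xi \x rho) \x bernoulli_prob alpha)%E.
have PE (U : set (X * X)) (V : set X) (W : set bool) :
    measurable U -> measurable V ->
    P ((U `*` V) `*` W) = (xi U * rho V * bernoulli_prob alpha W)%E.
  move=> mU mV; rewrite [LHS]product_measure1E//; last exact: measurableX.
  by congr (_ * _)%E; exact: product_measure1E.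
have bernT : bernoulli_prob alpha [set true] = alpha%:E.
  by rewrite /bernoulli_prob alpha01 fsbig_set1.
have xi2 E : measurable E -> xi (setT `*` E) = m2 E.
  by move=> mE; have [] := cpl _ mE.
pose S : set ((X * X) * X * bool) := ((setT `*` C) `*` setT) `*` [set true].
have mS : measurable S.
  by do 2 ?apply: measurableX => //; exact: measurableX.
have PS E F : measurable E -> measurable F ->
    P (((setT `*` E) `*` F) `*` [set true]) = (alpha%:E * m2 E * rho F)%E.
  move=> mE mF; rewrite PE//; last exact: measurableX.
  by rewrite xi2// bernT muleC muleA.
pose phi (o : (X * X) * X * bool) : X * X :=
  (o.1.1.1, if o \in S then o.1.1.2 else o.1.2).
have m11 : measurable_fun setT (fun o : (X * X) * X * bool => o.1.1).
  by apply: measurableT_comp => //; exact: measurable_fst.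
have m111 : measurable_fun setT (fun o : (X * X) * X * bool => o.1.1.1).
  by apply: measurableT_comp m11; exact: measurable_fst.
have mphi : measurable_fun setT phi.
  apply: measurable_fun_pair => //.
  apply: measurable_fun_ifT.
  - apply: (measurable_fun_bool true); rewrite setTI.
    rewrite (_ : _ @^-1` _ = S)//; apply/seteqP; split => o/=.
      by move=> /set_mem.
    by move=> So; rewrite mem_set.
  - by apply: measurableT_comp m11; exact: measurable_snd.
  - by apply: measurableT_comp; [exact: measurable_snd|exact: measurable_fst].
have mdE : measurable_fun setT (EFin \o (fun z : X * X => (mdist z.1 z.2 : R))).
  exact: measurableT_comp.
have S1 : P S = (alpha%:E * m2 C)%E.
  by rewrite PS// probability_setT mule1.
pose phim : {mfun ((X * X) * X * bool)%type >-> (X * X)%type} :=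
  HB.pack phi (isMeasurableFun.Build _ _ _ _ _ mphi).
exists (distribution P phim).
  move=> E mE; split.
    have <- := (cpl _ mE).1.
    rewrite /distribution/= /pushforward.
    rewrite (_ : _ @^-1` _ = ((E `*` setT) `*` setT) `*` setT).
      by rewrite PE//; [rewrite !probability_setT !mule1|exact: measurableX].
    by apply/seteqP; split => [[[[x z] w] t]/= []|[[[x z] w] t]/= [[[]]]].
  rewrite m3E// /distribution/= /pushforward.
  (* Split according to [S]: either the second coordinate stays and lies in [E], or it is replaced
     by a point of [E]. The two masses are the two terms of the formula for [m3]. *)
  rewrite (_ : _ @^-1` _ =
      ((setT `*` (E `&` C)) `*` setT) `*` [set true] `|`
      (((setT `*` setT) `*` E) `*` setT) `\` S); last first.
    apply/seteqP; split => [[[[x z] w] t]/= [_]|[[[x z] w] t]/=].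
      case: ifPn => [|]; rewrite ?inE ?notin_setE.
        by move=> [[[_ Cz] _] tt] Ez; left.
      by move=> nS Ew; right.
    case=> [[[[_ [Ez Cz]] _] ->]|[[[_ Ew] _] nS]]; split => //.
      by rewrite mem_set.
    by rewrite memNset.
  have mEC : measurable (E `&` C) by exact: measurableI.
  have mTE : measurable
      (((setT `*` setT) `*` E) `*` setT : set ((X * X) * X * bool)).
    by do 2 apply: measurableX => //; exact: measurableX.
  have mTEC : measurable (((setT `*` (E `&` C)) `*` setT) `*` [set true] :
      set ((X * X) * X * bool)).
    by do 2 apply: measurableX => //; exact: measurableX.
  rewrite measureU//; last 2 first.
  - exact: measurableD.
  - rewrite -subset0 => -[[[x z] w] t] [/= [[[_ [_ Cz]] _] tt]] [_]; apply.
    by [].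
  congr (_ + _)%E; first by rewrite [LHS]PS// probability_setT mule1.
  rewrite measureD//; last first.
    by rewrite (le_lt_trans (probability_le1 _ _))// ltry.
  rewrite (_ : _ `&` S = ((setT `*` C) `*` E) `*` [set true]); last first.
    apply/seteqP; split => [[[[x z] w] t]|[[[x z] w] t]].
      by move=> [[[_ /= Ew] _] [[[_ Cz] _] tt]].
    by move=> [[[_ Cz] /= Ew] tt].
  rewrite muleBl ?mul1e; last 2 first.
  - exact: fin_num_measure.
  - by rewrite fin_num_adde_defr.
  congr (_ - _)%E; last exact: PS.
  rewrite [LHS]PE//; last exact: measurableX.
  by rewrite setXTT !probability_setT mul1e mule1.
rewrite ge0_integral_pushforward//; last first.
  by move=> z _; rewrite lee_fin mdist_ge0.
rewrite preimage_setT.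
(* Off [S] the triangle inequality adds at most [L] to the old cost. This holds almost everywhere
   only: the exceptional null set is where the old second coordinate leaves [A] or the [rho]-point
   leaves [B]. *)
apply: (@le_trans _ _ (\int[P]_o ((mdist o.1.1.1 o.1.1.2)%:E +
                                 L%:E * (\1_(~` S) o)%:E))%E).
  apply: ae_ge0_le_integral => //.
  - by move=> o _; rewrite lee_fin mdist_ge0.
  - exact: (measurableT_comp mdE mphi).
  - by move=> o _; rewrite adde_ge0 ?mule_ge0 ?lee_fin ?mdist_ge0.
  - apply: emeasurable_funD; first exact: (measurableT_comp mdE m11).
    apply: measurable_funeM; apply: measurableT_comp => //.
    by apply: measurable_indic; exact: measurableC.
  have mbad1 : measurable
      (((setT `*` ~` A) `*` setT) `*` setT : set ((X * X) * X * bool)).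
    by do 3 apply: measurableX => //; exact: measurableC.
  have mbad2 : measurable
      (((setT `*` setT) `*` ~` B) `*` setT : set ((X * X) * X * bool)).
    by do 2 apply: measurableX => //; [exact: measurableX|exact: measurableC].
  have bad1 : P (((setT `*` ~` A) `*` setT) `*` setT) = 0%E.
    rewrite PE//; last by apply: measurableX => //; exact: measurableC.
    by rewrite xi2 ?m2A ?mul0e//; exact: measurableC.
  have bad2 : P (((setT `*` setT) `*` ~` B) `*` setT) = 0%E.
    rewrite PE//; [|exact: measurableX|exact: measurableC].
    by rewrite rhoB mule0 mul0e.
  exists (((setT `*` ~` A) `*` setT) `*` setT `|`
    ((setT `*` setT) `*` ~` B) `*` setT).
  split; first exact: measurableU.
    apply/eqP; rewrite eq_le measure_ge0 andbT -(adde0 0%E).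
    apply: le_trans.
      by apply: measureU2 => //; exact: measurableU.
    by apply: leeD; [rewrite -bad1|rewrite -bad2].
  move=> [[[x z] w] t]/= H; apply: contrapT => /not_orP[nA nB]; apply: H => _.
  have Az : A z by apply: contrapT => ?; apply: nA.
  have Bw : B w by apply: contrapT => ?; apply: nB.
  rewrite indicC; case: (boolP (_ \in S)) => _ /=;
    rewrite -EFinM -EFinD lee_fin.
    by rewrite mulr0 addr0.
  rewrite mulr1; have := metric_triangle x z w; have := ABL _ _ Az Bw; lra.
rewrite ge0_integralD//; last 4 first.
- by move=> o _; rewrite lee_fin mdist_ge0.
- exact: (measurableT_comp mdE m11).
- by move=> o _; rewrite mule_ge0 ?lee_fin.
- apply: measurable_funeM; apply: measurableT_comp => //.
  by apply: measurable_indic; exact: measurableC.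
apply: leeD.
  rewrite -[X in (X <= _)%E](@ge0_integral_pushforward _ _ _ _ _ _ m11 P setT
    (fun z : X * X => (mdist z.1 z.2 : R)%:E))//; last first.
    by move=> z _; rewrite lee_fin mdist_ge0.
  rewrite (@eq_measure_integral _ _ _ _ xi)// => U mU _.
  rewrite /= /pushforward (_ : _ @^-1` _ = (U `*` setT) `*` setT); last first.
    by apply/seteqP; split => [[[[x z] w] t]|[[[x z] w] t] [[]]].
  by rewrite [LHS]PE// !probability_setT !mule1.
rewrite ge0_integralZl//; last first.
- by apply: measurableT_comp => //; apply: measurable_indic; exact: measurableC.
rewrite integral_indic//; last exact: measurableC.
by rewrite setIT [X in (_ * X <= _)%E](probability_setC P mS) S1.
Qed.

(** Base case of the chain of couplings: the push-forward under the diagonal map costs nothing. *)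
Lemma diagonal_coupling {d : measure_display} {R : realType}
    {X : completeBorelMetricType d R} (m : probability X R) :
  separable_space X ->
  exists2 xi : probability (X * X)%type R, coupling m m xi &
    (\int[xi]_z (mdist z.1 z.2)%:E = 0)%E.
Proof.
move=> sepX; have md := measurable_mdist sepX.
have mdiag : measurable_fun setT (fun x : X => (x, x)).
  exact: measurable_fun_pair.
pose diag : {mfun X >-> (X * X)%type} :=
  HB.pack (fun x : X => (x, x)) (isMeasurableFun.Build _ _ _ _ _ mdiag).
exists (distribution m diag).
  move=> A mA; rewrite /distribution /pushforward /=.
  by split; congr (m _); apply/seteqP; split=> [x []|x Ax].
rewrite ge0_integral_pushforward//; first last.
- by move=> z _; rewrite lee_fin mdist_ge0.
- exact: measurableT_comp.
by rewrite integral0_eq// => x _ /=; rewrite mdistxx.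
Qed.

(** * One step of the random walk between neighbouring centres *)

(** Subtracting the retained part from the uniform law on [B] leaves density
    [1 / nu B - (1 - eta) / nu C] on [C] and [1 / nu B] on the rest of [B]. The hypothesis on [nu C]
    makes the first density nonnegative; the total mass is [eta], and [rho] is the normalization. *)
Lemma residual_probability {d : measure_display} {R : realType}
    {X : completeBorelMetricType d R} (nu : {measure set X -> \bar R})
    (B C : set X) (eta : R) :
  measurable B -> measurable C -> C `<=` B ->
  (0 < nu C)%E -> (nu B < +oo)%E -> 0 < eta < 1 ->
  ((1 - eta)%:E * nu B <= nu C)%E ->
  exists2 rho : probability X R, rho (~` B) = 0%E &
    forall E, measurable E ->
      (nu (E `&` B) / nu B =
       ((1 - eta) / fine (nu C))%:E * nu (E `&` C) + eta%:E * rho E)%E.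
Proof.
move=> mB mC CB C0 Boo /andP[eta0 eta1] hC.
have mBC : measurable (B `\` C) by exact: measurableD.
have fin E : measurable E -> E `<=` B -> nu E \is a fin_num.
  move=> mE EB; rewrite ge0_fin_numE// (le_lt_trans _ Boo)//.
  by rewrite le_measure ?inE.
have finC : nu C \is a fin_num by exact: fin.
have finB : nu B \is a fin_num by exact: fin.
set c := fine (nu C); set b := fine (nu B).
have cE : nu C = c%:E by rewrite fineK.
have bE : nu B = b%:E by rewrite fineK.
have c0 : 0 < c by rewrite -lte_fin -cE.
have cb : c <= b by rewrite -lee_fin -cE -bE le_measure ?inE.
have b0 : 0 < b by exact: lt_le_trans cb.
have hcb : (1 - eta) * b <= c by rewrite -lee_fin -cE EFinM -bE.
have p0 : 0 <= b^-1 - (1 - eta) / c.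
  by rewrite subr_ge0 ler_pdivrMr// mulrC ler_pdivlMr.
have q0 : 0 <= b^-1 by rewrite invr_ge0 ltW.
pose lam : {measure set X -> \bar R} :=
  measure_add (mscale (NngNum p0) (mrestr nu mC))
  (mscale (NngNum q0) (mrestr nu mBC)).
have lamE E : lam E = ((b^-1 - (1 - eta) / c)%:E * nu (E `&` C) +
    (b^-1)%:E * nu (E `&` (B `\` C)))%E.
  by rewrite [LHS]measure_addE.
have BCE : nu (B `\` C) = (b - c)%:E.
  by rewrite [LHS]measureD// (setIidr CB) EFinB -bE -cE.
have lamT : lam setT = eta%:E.
  rewrite lamE !setTI BCE cE -!EFinM -EFinD; congr EFin.
  by field; rewrite !gt_eqF.
(* The total mass [eta] is positive and finite, so the default Dirac mass never appears. *)
exists (mnormalize lam \d_point).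
  rewrite /= /mnormalize lamT gt_eqF//= lamE.
  have -> : ~` B `&` C = set0 by rewrite -subset0 => x [nB /CB].
  have -> : ~` B `&` (B `\` C) = set0 by rewrite -subset0 => x [nB []].
  by rewrite measure0 !mule0 adde0 mul0e.
move=> E mE; rewrite /= /mnormalize lamT gt_eqF//= lamE.
have -> : nu (E `&` B) = (nu (E `&` C) + nu (E `&` (B `\` C)))%E.
  rewrite -measureU//; last 3 first.
  - exact: measurableI.
  - exact: measurableI.
  - by rewrite -subset0 => x [[_ Cx] [_ [_]]].
  by rewrite -setIUr setDUK.
have finEC : nu (E `&` C) \is a fin_num.
  by apply: fin; [exact: measurableI|move=> x [_ /CB]].
have finED : nu (E `&` (B `\` C)) \is a fin_num.
  by apply: fin; [exact: measurableI|move=> x [_ []]].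
rewrite -(fineK finEC) -(fineK finED) bE inver (gt_eqF b0).
rewrite -!EFinM -!EFinD; congr EFin.
by field; rewrite !gt_eqF.
Qed.

(** Exactly the mass [1 - eta], spread uniformly over the intersection of the balls, stays in place.
    Comparing the intersection with the first ball allows this mass to be kept; comparing it with
    the second leaves a genuine probability for the mass that moves. *)
Lemma random_walk_extend {d : measure_display} {R : realType}
    {X : completeBorelMetricType d R} (nu : {measure set X -> \bar R})
    (m : probability X R) (xi : probability (X * X)%type R)
    (r delta eta : R) (x y : X) :
  metric_measure_space nu -> 0 < r -> 0 <= delta -> mdist x y <= delta ->
  0 < eta < 1 ->
  ((1 - eta)%:E * nu (ball x r) <= nu (ball x r `&` ball y r))%E ->
  ((1 - eta)%:E * nu (ball y r) <= nu (ball x r `&` ball y r))%E ->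
  coupling m (random_walk nu r x) xi ->
  exists2 xi' : probability (X * X)%type R,
    coupling m (random_walk nu r y) xi' &
    (\int[xi']_z (mdist z.1 z.2)%:E <=
     \int[xi]_z (mdist z.1 z.2)%:E + ((2 * r + delta) * eta)%:E)%E.
Proof.
move=> [sepX _ ballX] r0 delta0 xy eta01 hx hy cpl.
have /andP[eta0 eta1] := eta01.
have mA := measurable_mball x r; have mB := measurable_mball y r.
set A := ball x r in mA hx hy *; set B := ball y r in mB hx hy *.
have mC : measurable (A `&` B) by exact: measurableI.
set C := A `&` B in mC hx hy *.
have A0 := ballX x r r0; have B0 := ballX y r r0.
have /andP[A0' Aoo] := A0; have /andP[_ Boo] := B0.
have C0 : (0 < nu C)%E.
  by rewrite (lt_le_trans _ hx)// mule_gt0// lte_fin subr_gt0.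
have Coo : (nu C < +oo)%E.
  by rewrite (le_lt_trans _ Aoo)// le_measure ?inE//; exact: subIsetl.
have [rho rhoB rhoE] :=
  residual_probability nu B C eta mB mC (@subIsetr _ _ _) C0 Boo eta01 hy.
have finA : nu A \is a fin_num by rewrite ge0_fin_numE.
have finC : nu C \is a fin_num by rewrite ge0_fin_numE.
set a := fine (nu A); set c := fine (nu C).
have aE : nu A = a%:E by rewrite fineK.
have cE : nu C = c%:E by rewrite fineK.
have a0 : 0 < a by rewrite -lte_fin -aE.
have c0 : 0 < c by rewrite -lte_fin -cE.
(* Chosen so that [alpha] times the mass of [C] under the walk from [x] equals [1 - eta]; [hx] gives
   [alpha <= 1]. *)
pose alpha := (1 - eta) * a / c.
have alphaE E : measurable E ->
    (alpha%:E * random_walk nu r x (E `&` C) =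
     ((1 - eta) / c)%:E * nu (E `&` C))%E.
  move=> mE; rewrite random_walkE// -/A.
  have -> : E `&` C `&` A = E `&` C.
    by rewrite -setIA (setIidl (@subIsetl _ A B)).
  have finEC : nu (E `&` C) \is a fin_num.
    rewrite ge0_fin_numE// (le_lt_trans _ Coo)// le_measure ?inE//.
    exact: measurableI.
  rewrite -(fineK finEC) aE inver gt_eqF// -!EFinM; congr EFin.
  by rewrite /alpha; field; rewrite !gt_eqF.
have alphaC : (alpha%:E * random_walk nu r x C = (1 - eta)%:E)%E.
  have := alphaE _ measurableT; rewrite !setTI => ->.
  by rewrite cE -EFinM divfK// gt_eqF.
have alphaC' : (1 - alpha%:E * random_walk nu r x C = eta%:E)%E.
  by rewrite alphaC -EFinB subKr.
rewrite EFinM -alphaC'.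
apply: (@coupling_extend _ _ _ m (random_walk nu r x) _ rho xi A B C) => //.
- rewrite /alpha divr_ge0/= ?mulr_ge0 ?subr_ge0//; try exact: ltW.
  by rewrite ler_pdivrMr// mul1r -lee_fin -cE EFinM -aE.
- by rewrite addr_ge0// mulr_ge0// ltW.
- by move=> E mE; rewrite alphaC' alphaE// -rhoE// random_walkE.
- by rewrite random_walkE// setICl measure0 mul0e.
- move=> z w; rewrite /A /B !ballEmdist/= => xz yw.
  have := metric_triangle z x w; have := metric_triangle x y w.
  rewrite (metric_sym z x); lra.
Qed.

(** * The model function and its integral *)

Lemma powR_continuous_at {R : realType} (p a : R) :
  0 < a -> {for a, continuous (fun x : R => x `^ p)}.
Proof.
move=> a0; apply: differentiable_continuous; apply/derivable1_diffP.
by apply: derivable_powR; rewrite in_itv/= a0.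
Qed.

Lemma sinh_continuous {R : realType} : continuous (@sinh R).
Proof.
move=> t.
have : {for t, continuous ((expR \- (expR \o -%R)) \* cst (2^-1 : R))}.
  apply: continuousM; last exact: cst_continuous.
  apply: continuousB; first exact: continuous_expR.
  by apply: continuous_comp; [exact: opp_continuous|exact: continuous_expR].
exact.
Qed.

Lemma s_KN_continuous {R : realType} (K N : R) : continuous (s_KN K N).
Proof.
have scale (g : R -> R) (a b : R) :
    continuous g -> continuous (fun t : R => a * g (t * b)).
  move=> cg t.
  have : {for t, continuous (cst a \* (g \o *%R^~ b))}.
    apply: continuousM; first exact: cst_continuous.
    by apply: continuous_comp; [exact: mulrr_continuous|exact: cg].
  exact.
rewrite /s_KN; case: (0 < K); first by apply: scale; exact: continuous_sin.
case: (K == 0); first by move=> t; exact: cvg_id.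
by apply: scale; exact: sinh_continuous.
Qed.

(** For [K > 0] the strict radius bound keeps the argument of the sine below [pi]. Positivity gives
    access to [powR_continuous_at] at [s_KN K N r]. *)
Lemma s_KN_gt0 {R : realType} (K N r : R) :
  1 < N -> 0 < r -> (r%:E < radius_bound K N)%E -> 0 < s_KN K N r.
Proof.
move=> N1 r0; have N0 : 0 < N - 1 by rewrite subr_gt0.
rewrite /radius_bound /s_KN; have [K0|K0] := ltP 0 K.
  rewrite (gt_eqF K0) lte_fin => rK.
  have q0 : 0 < Num.sqrt (K / (N - 1)) by rewrite sqrtr_gt0 divr_gt0.
  rewrite mulr_gt0 ?sqrtr_gt0 ?divr_gt0//; apply: sin_gt0_pi.
  rewrite mulr_gt0//=.
  have qV : Num.sqrt ((N - 1) / K) = (Num.sqrt (K / (N - 1)))^-1.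
    by rewrite -sqrtrV ?divr_ge0 ?ltW// invf_div.
  by move: rK; rewrite qV ltr_pdivlMr.
move=> _; case: ifPn => // Kn0.
have {}K0 : 0 < - K by rewrite oppr_gt0 lt_neqAle Kn0.
have q0 : 0 < Num.sqrt (- K / (N - 1)) by rewrite sqrtr_gt0 divr_gt0.
rewrite mulr_gt0 ?sqrtr_gt0 ?divr_gt0// subr_gt0 ltr_expR.
by rewrite gtrN// mulr_gt0.
Qed.

Lemma int_s_KN_ge0 {R : realType} (K N r : R) : 0 <= int_s_KN K N r.
Proof. by apply: Rintegral_ge0 => t _; exact: powR_ge0. Qed.

(* A nonzero value excludes the junk value [fine +oo = 0] of [int_s_KN]. *)
Lemma integrable_s_KN {R : realType} (K N r : R) : int_s_KN K N r != 0 ->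
  (@lebesgue_measure R).-integrable `[0, r]
    (EFin \o (fun t => s_KN K N t `^ (N - 1))).
Proof.
move=> I0; have mf : measurable_fun `[0, r] (fun t => s_KN K N t `^ (N - 1)).
  apply: measurable_funTS.
  apply: (measurableT_comp (measurable_powR (N - 1))).
  by apply: continuous_measurable_fun; exact: s_KN_continuous.
apply/integrableP; split; first exact: measurableT_comp.
under eq_integral do rewrite /= ger0_norm ?powR_ge0//.
rewrite ltey; apply: contra I0 => /eqP Ioo.
by rewrite /int_s_KN /Rintegral Ioo.
Qed.

(** A one-sided derivative bound: by continuity at [r], the integrand stays below its value at [r]
    plus [e] on a short interval to the left. Continuity is used instead of monotonicity because the
    sine may already be decreasing there. *)
Lemma int_s_KN_increment {R : realType} (K N r e : R) :
  1 < N -> 0 < r -> (r%:E < radius_bound K N)%E -> int_s_KN K N r != 0 ->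
  0 < e ->
  exists2 delta0 : R, 0 < delta0 & forall delta, 0 < delta < delta0 ->
    int_s_KN K N r - int_s_KN K N (r - delta) <=
    delta * (s_KN K N r `^ (N - 1) + e).
Proof.
move=> N1 r0 hr I0 e0; have s0 := s_KN_gt0 K N r N1 r0 hr.
have fr : {for r, continuous (fun t => s_KN K N t `^ (N - 1))}.
  apply: (@continuous_comp _ _ _ (s_KN K N) (fun x => x `^ (N - 1))).
    exact: s_KN_continuous.
  exact: powR_continuous_at.
have /cvgrPdist_lt/(_ _ e0)[d/= d0 rd] := fr.
(* The bound by [r] keeps [r - delta] inside the interval of integration. *)
exists (Num.min d r); first by rewrite lt_min d0.
move=> delta /andP[delta0]; rewrite lt_min => /andP[deltad deltar].
have intf := integrable_s_KN K N r I0.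
rewrite /int_s_KN Rintegral_itvB//; last 2 first.
- by rewrite bnd_simp subr_ge0 ltW.
- by rewrite bnd_simp gerBl ltW.
have mu_itv : lebesgue_measure `]r - delta, r] = delta%:E.
  rewrite lebesgue_measure_itv/= lte_fin gtrBl delta0 -EFinB.
  by rewrite opprB addrC subrK.
have -> : delta * (s_KN K N r `^ (N - 1) + e) =
    \int[lebesgue_measure]_(t in `]r - delta, r]) (s_KN K N r `^ (N - 1) + e).
  by rewrite Rintegral_cst// [X in fine X]mu_itv mulrC.
apply: le_Rintegral => //.
- apply: integrableS intf => // t/=; rewrite !in_itv/= => /andP[t1 ->].
  by rewrite andbT ltW// (lt_trans _ t1)// subr_gt0.
- apply/integrableP; split; first exact: measurable_cst.
  rewrite (eq_integral (cst `|(s_KN K N r `^ (N - 1) + e)%:E|%E))//.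
  by rewrite integral_cst// [X in (_ * X)%E]mu_itv -EFinM ltry.
- move=> t/=; rewrite in_itv/= => /andP[t1 t2].
  have : `|r - t| < d by rewrite ger0_norm ?subr_ge0//; lra.
  by move=> /rd; rewrite ltr_distlC => /andP[_ /ltW].
Qed.

(** * Consequences of Bishop-Gromov *)

(** Balls have positive finite mass, so the left-hand ratio in Bishop-Gromov is positive. This
    forces both model integrals to be nonzero, since division by zero would give zero, and the
    inequality can be cross-multiplied. *)
Lemma BG_ratio {d : measure_display} {R : realType}
    {X : completeBorelMetricType d R} (nu : {measure set X -> \bar R})
    (K N r s : R) (x : X) :
  metric_measure_space nu -> BG K N nu -> 0 < s < r ->
  (r%:E <= radius_bound K N)%E ->
  0 < int_s_KN K N r /\
  ((int_s_KN K N s)%:E * nu (ball x r) <=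
   (int_s_KN K N r)%:E * nu (ball x s))%E.
Proof.
move=> [_ _ ballX] hBG /andP[s0 sr] hr.
have r0 : 0 < r by exact: lt_trans sr.
have fin t : 0 < t -> exists2 v, nu (ball x t) = v%:E & 0 < v.
  move=> /(ballX x)/andP[v0 voo]; exists (fine (nu (ball x t))).
    by rewrite fineK// ge0_fin_numE.
  by rewrite fine_gt0// v0.
have [v vE v0] := fin _ r0; have [u uE u0] := fin _ s0.
have := hBG x s r s0 sr hr; rewrite vE uE inver (gt_eqF u0) -EFinM lee_fin.
have := int_s_KN_ge0 K N r; have := int_s_KN_ge0 K N s.
move: (int_s_KN K N r) (int_s_KN K N s) => I J J0 I0 IJ.
have {}IJ0 : 0 < I / J by rewrite (lt_le_trans _ IJ)// divr_gt0.
have {}J0 : 0 < J.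
  rewrite lt_neqAle J0 andbT; apply: contraTneq IJ0 => <-.
  by rewrite invr0 mulr0 ltxx.
have {}I0 : 0 < I by move: IJ0; rewrite pmulr_lgt0// invr_gt0.
split=> //; rewrite -!EFinM lee_fin mulrC.
by move: IJ; rewrite ler_pdivrMr// mulrAC ler_pdivlMr.
Qed.

Lemma BG_ball_shrink {d : measure_display} {R : realType}
    {X : completeBorelMetricType d R} (nu : {measure set X -> \bar R})
    (K N r delta eta : R) (x : X) :
  metric_measure_space nu -> BG K N nu -> 0 < delta < r ->
  (r%:E <= radius_bound K N)%E ->
  int_s_KN K N r - int_s_KN K N (r - delta) <= eta * int_s_KN K N r ->
  ((1 - eta)%:E * nu (ball x r) <= nu (ball x (r - delta)))%E.
Proof.
move=> hX hBG /andP[delta0 deltar] hr hI.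
have sr : 0 < r - delta < r by rewrite subr_gt0 deltar gtrBl.
have [I0 IJ] := BG_ratio nu K N r (r - delta) x hX hBG sr hr.
rewrite -(@lee_pmul2l _ (int_s_KN K N r)%:E) ?lte_fin//.
apply: le_trans IJ; rewrite muleA -EFinM; apply: lee_wpmul2r => //.
by rewrite lee_fin; lra.
Qed.

(** * Transport along a geodesic and the curvature bound *)

Lemma W1_random_walk_le {d : measure_display} {R : realType}
    {X : completeBorelMetricType d R} (nu : {measure set X -> \bar R})
    (r eta : R) (n : nat) (x y : X) :
  metric_measure_space nu -> geodesic_space X -> (0 < n)%N -> 0 < eta < 1 ->
  mdist x y / n%:R < r ->
  (forall p : X, ((1 - eta)%:E * nu (ball p r) <=
                  nu (ball p (r - mdist x y / n%:R)))%E) ->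
  (W1 (random_walk nu r x) (random_walk nu r y) <=
   (n%:R * ((2 * r + mdist x y / n%:R) * eta))%:E)%E.
Proof.
move=> hX hgeo n0 eta01; set delta := mdist x y / n%:R => deltar hball.
have n0' : 0 < n%:R :> R by rewrite ltr0n.
have delta0 : 0 <= delta by rewrite divr_ge0 ?mdist_ge0.
have r0 : 0 < r by exact: le_lt_trans deltar.
(* By the triangle inequality, shrinking the radius by [delta] puts the ball around [p] inside both
   balls of radius [r]. *)
have ball_sub (p q : X) : mdist p q <= delta ->
    ((1 - eta)%:E * nu (ball p r) <= nu (ball p r `&` ball q r))%E.
  move=> pq; apply: (le_trans (hball p)).
  apply: le_measure; rewrite ?inE; [exact: measurable_mball| |].
    by apply: measurableI; exact: measurable_mball.
  move=> z; rewrite !ballEmdist/= => pz.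
  by have := metric_triangle q p z; rewrite (metric_sym q p); split; lra.
have [gamma [g0 g1 gd]] := hgeo x y.
pose p k := gamma (k%:R / n%:R).
have pS k : (k < n)%N -> mdist (p k) (p k.+1) <= delta.
  move=> kn; rewrite gd.
  - rewrite -mulrBl -natr1 opprD addNKr normrM normrN1 mul1r.
    by rewrite ger0_norm ?invr_ge0 ?ler0n// /delta mulrC.
  - by rewrite divr_ge0//= ler_pdivrMr// mul1r ler_nat ltnW.
  - by rewrite divr_ge0//= ler_pdivrMr// mul1r ler_nat.
(* The first marginal stays fixed while the second advances by one point, so each step adds one term
   to the cost. *)
have chain k : (k <= n)%N ->
    exists2 xi : probability (X * X)%type R,
      coupling (random_walk nu r x) (random_walk nu r (p k)) xi &
      (\int[xi]_z (mdist z.1 z.2)%:E <=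
       (k%:R * ((2 * r + delta) * eta))%:E)%E.
  elim: k => [_|k IHk kn].
    have [sepX _ _] := hX.
    have [xi cpl cost] := diagonal_coupling (random_walk nu r x) sepX.
    by exists xi; rewrite ?cost ?mul0r// /p mul0r g0.
  have [xi cpl cost] := IHk (ltnW kn).
  have [|xi' cpl' cost'] := random_walk_extend nu (random_walk nu r x) xi r
    delta eta (p k) (p k.+1) hX r0 delta0 (pS k kn) eta01
    (ball_sub _ _ (pS k kn)) _ cpl.
    by rewrite setIC; apply: ball_sub; rewrite metric_sym; exact: pS.
  exists xi' => //; apply: (le_trans cost').
  by rewrite -(natr1 k) [X in (_ <= X%:E)%E]mulrDl mul1r EFinD; apply: leeD.
have [xi cpl cost] := chain n (leqnn n).
have pn : p n = y by rewrite /p divff ?gt_eqF.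
rewrite pn in cpl; apply: le_trans cost.
by apply: ereal_inf_lbound; exists xi.
Qed.

Lemma coarse_ricci_ge {d : measure_display} {R : realType}
    {X : completeBorelMetricType d R} (m : X -> probability X R)
    (x y : X) (c : R) :
  x <> y -> (W1 (m x) (m y) <= (mdist x y * c)%:E)%E ->
  ((1 - c)%:E <= coarse_ricci m x y)%E.
Proof.
move=> /eqP xy hW; have D0 : 0 < mdist x y by rewrite mdist_gt0.
rewrite /coarse_ricci EFinB leeB// inver gt_eqF// lee_pdivrMr//.
by rewrite -EFinM mulrC.
Qed.

Theorem theorem1p3 (d : measure_display) (R : realType)
    (X : completeBorelMetricType d R) (nu : {measure set X -> \bar R})
    (K N : R) (hN : 1 < N)
    (hX : metric_measure_space nu) (hgeo : geodesic_space X)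
    (hBG : BG K N nu)
    (r : R) (hr0 : 0 < r) (hr : (r%:E < radius_bound K N)%E) :
  ((1 - 2 * r * (s_KN K N r `^ (N - 1) / int_s_KN K N r))%:E <=
   ereal_inf [set coarse_ricci (random_walk nu r) xy.1 xy.2
             | xy in [set xy : X * X | xy.1 <> xy.2]])%E.
Proof.
apply/ereal_infP => _ [[x y]/= xy <-]; apply/lee_addgt0Pr => e e0.
have I0 : 0 < int_s_KN K N r.
  have r2 : 0 < r / 2 < r by rewrite divr_gt0//= ltr_pdivrMr// ltr_pMr// ltr1n.
  exact: (BG_ratio nu K N r (r / 2) x hX hBG r2 (ltW hr)).1.
have := powR_ge0 (s_KN K N r) (N - 1).
have := int_s_KN_increment K N r _ hN hr0 hr (lt0r_neq0 I0).
set f := s_KN K N r `^ (N - 1); set I := int_s_KN K N r in I0 * => incr f0.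
(* The final excess is [2 * r * e' + delta * (f + e')]; once [delta <= e' <= 1] it is at most
   [e' * (2 * r + f + 1)], which must not exceed [e * I]. *)
pose e' := Num.min 1 (e * I / (2 * r + f + 1)).
have den0 : 0 < 2 * r + f + 1 by lra.
have e'0 : 0 < e' by rewrite lt_min ltr01 divr_gt0// mulr_gt0.
have e'1 : e' <= 1 by rewrite ge_min lexx.
have e'e : e' * (2 * r + f + 1) <= e * I.
  by rewrite -ler_pdivlMr// ge_min lexx orbT.
clearbody e'.
have [delta0 delta0_gt0 {}incr] := incr _ e'0.
have D0 : 0 < mdist x y by rewrite mdist_gt0; exact/eqP.
(* The four bounds on [delta] serve, in order, the increment estimate, the positivity of
   [r - delta], the error budget and [eta < 1]. *)
pose b := Num.min (Num.min delta0 r) (Num.min e' (I / (f + e'))).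
have fe0 : 0 < f + e' by lra.
have b0 : 0 < b by rewrite !lt_min delta0_gt0 hr0 e'0 divr_gt0.
(* The successor makes [n] strictly larger than [mdist x y / b], hence [delta < b]. *)
pose n := (Num.trunc (mdist x y / b)).+1.
have n0 : 0 < n%:R :> R by rewrite ltr0n.
have Dn : mdist x y / n%:R < b.
  by rewrite ltr_pdivrMr// -ltr_pdivrMl// mulrC truncnS_gt.
set delta := mdist x y / n%:R in Dn *.
have delta_gt0 : 0 < delta by rewrite divr_gt0.
move: (Dn); rewrite !lt_min => /andP[/andP[d1 d2] /andP[d3 d4]].
(* The increment estimate reads [I - int_s_KN K N (r - delta) <= eta * I], and
   [n * delta = mdist x y] removes [n] from the total cost. *)
pose eta := delta * (f + e') / I.
have eta01 : 0 < eta < 1.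
  apply/andP; split; first by rewrite divr_gt0// mulr_gt0.
  by rewrite /eta ltr_pdivrMr// mul1r -ltr_pdivlMr.
have hW : (W1 (random_walk nu r x) (random_walk nu r y) <=
    (mdist x y * ((2 * r + delta) * (f + e') / I))%:E)%E.
  have -> : mdist x y * ((2 * r + delta) * (f + e') / I) =
      n%:R * ((2 * r + delta) * eta).
    by rewrite /eta /delta; field; rewrite !gt_eqF.
  apply: W1_random_walk_le => // p.
  apply: (@BG_ball_shrink _ _ _ nu K N) => //; [|exact: ltW|].
    by rewrite delta_gt0.
  by rewrite /eta divfK ?gt_eqF//; apply: incr; rewrite delta_gt0.
have := coarse_ricci_ge (random_walk nu r) x y _ xy hW.
move=> /(leeD2r e%:E); apply: le_trans; rewrite -EFinD lee_fin.
suff : (2 * r + delta) * (f + e') / I <= 2 * r * (f / I) + e by lra.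
rewrite mulrA -lerBlDl -mulrBl ler_pdivrMr//.
apply: le_trans e'e.
have : delta * (f + e') <= e' * (f + 1) by apply: ler_pM; lra.
lra.
Qed.
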